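(* Assume $f\in\mathbb{V}_h$. Let $u\in H^s_0(\Omega)$ satisfy $$a(u,v-u)+j_S(v)-j_S(u)\ge\langle f,v-u\rangle\qquad\text{for all }v\in H^s_0(\Omega),$$ and let $u_h\in\mathbb{V}_h$ satisfy $a(u_h,v_h-u_h)+j_S(v_h)-j_S(u_h)\ge\langle f,v_h-u_h\rangle$ for all $v_h\in\mathbb{V}_h$. Define $\sigma\in H^{-s}(\Omega)$ by $\langle\sigma,v\rangle=\langle f,v\rangle-a(u,v)$ for all $v\in H^s_0(\Omega)$, define $\sigma_h\in\mathbb{V}_h$ by $\langle\sigma_h,v_h\rangle=\langle f,v_h\rangle-a(u_h,v_h)$ for all $v_h\in\mathbb{V}_h$, and let $r_h=f-(-\Delta)^su_h$. Then $$\begin{aligned}\|u-u_h\|_{H^s_0(\Omega)}^2+\|\sigma-\sigma_h\|_{H^{-s}(\Omega)}^2\lesssim{}&\|r_h-\sigma_h\|_{H^{-s}(\Omega)}^2+\|(|\sigma_h|-\mathcal{F})^+\|_{H^{-s}(\Omega)}^2\\&+\langle(|\sigma_h|-\mathcal{F})^-,|u_h|\rangle-\langle\sigma_h,u_h\rangle+\langle|\sigma_h|,|u_h|\rangle.\end{aligned}$$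
   Context: Let $0<s<1$ and let $\Omega\subset\mathbb{R}^n$ be a bounded Lipschitz domain with polygonal boundary. $H^s(\Omega)$ has norm $\|v\|_{L^2(\Omega)}+|v|_{H^s(\Omega)}$, $|v|^2_{H^s(\Omega)}=\iint_{\Omega\times\Omega}\frac{(v(x)-v(y))^2}{|x-y|^{n+2s}}\,dy\,dx$. $H^s_0(\Omega)$ is the closure in $H^s(\Omega)$ of the $v\in C^\infty(\overline\Omega)$ vanishing on $\partial\Omega$, $H^{-s}(\Omega)$ its dual, $\langle\cdot,\cdot\rangle$ the duality pairing (extending the $L^2(\Omega)$ inner product). Functions are extended by $0$ to $\mathbb{R}^n\setminus\overline\Omega$, and $$a(u,v)=\frac{c_{n,s}}2\iint_{(\Omega\times\mathbb{R}^n)\cup(\mathbb{R}^n\times\Omega)}\frac{(u(x)-u(y))(v(x)-v(y))}{|x-y|^{n+2s}}\,dy\,dx,\qquad c_{n,s}=\frac{2^{2s}s\,\Gamma(\frac{n+2s}2)}{\pi^{n/2}\Gamma(1-s)}.$$ Standing fact: $a$ is continuous and coercive on $H^s_0(\Omega)$. $(-\Delta)^s:H^s_0(\Omega)\to H^{-s}(\Omega)$ is given by $\langle(-\Delta)^su,v\rangle=a(u,v)$. $\mathbb{V}_h\subset H^s_0(\Omega)$ is the space of continuous piecewise linear functions on a shape-regular triangulation $\mathcal{T}_h$ of $\Omega$ vanishing on $\partial\Omega$. The friction functional is $j_S(v)=\int_S\mathcal{F}|v|\,dx$ with $S\subset\Omega$ open and $\mathcal{F}\in L^\infty(\Omega)$,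 $\mathcal{F}\ge0$; in the estimate $\mathcal{F}$ is understood to be $0$ outside $S$, so $j_S(v)=\langle\mathcal{F},|v|\rangle$. For a real function $x$, $x^+=\max(x,0)$ and $x^-=\max(-x,0)$, so $x=x^+-x^-$. $X\lesssim Y$ means $X\le C'Y$ with $C'>0$ independent of the mesh size, the data and the solutions. *)

(* Defs.v *)
From HB Require Import structures.
From mathcomp Require Import all_boot all_order all_algebra.
From mathcomp Require Import all_classical all_reals all_analysis.

Set Implicit Arguments.
Unset Strict Implicit.
Unset Printing Implicit Defensive.

Import Order.TTheory GRing.Theory Num.Theory.
Import numFieldNormedType.Exports.

Local Open Scope classical_set_scope.
Local Open Scope ring_scope.


(* The sigma-algebra generated by the coordinate maps, i.e. the Borel
   sigma-algebra of R^n. *)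
Section rV_measurable.
Context {R : realType} {n : nat}.

Definition rV_coord (i : 'I_n) (x : 'rV[R]_n) : measurableTypeR R := x ord0 i.

Let rV_set0 : g_sigma_preimage rV_coord set0.
Proof. exact: sigma_algebra0. Qed.

Let rV_setC A : g_sigma_preimage rV_coord A -> g_sigma_preimage rV_coord (~` A).
Proof. exact: sigma_algebraC. Qed.

Let rV_bigcup (F : (set 'rV[R]_n)^nat) :
  (forall i, g_sigma_preimage rV_coord (F i)) ->
  g_sigma_preimage rV_coord (\bigcup_i (F i)).
Proof. exact: sigma_algebra_bigcup. Qed.

HB.instance Definition _ :=
  @isMeasurable.Build (measure_tuple_display default_measure_display)
    'rV[R]_n (g_sigma_preimage rV_coord) rV_set0 rV_setC rV_bigcup.

End rV_measurable.


Section rV_measurable_fun.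
Context {R : realType}.

Lemma measurable_rV_coord n (i : 'I_n) :
  measurable_fun [set: 'rV[R]_n] (@rV_coord R n i).
Proof.
move=> _ Y mY; rewrite setTI; apply: sub_sigma_algebra => /=.
rewrite -bigcup_seq/=; exists i => /=; first by rewrite mem_index_enum.
by exists Y => //; rewrite setTI.
Qed.

Lemma measurable_fun_rV d (T : measurableType d) n (f : T -> 'rV[R]_n) :
  (forall i, measurable_fun [set: T] (rV_coord i \o f)) ->
  measurable_fun [set: T] f.
Proof.
move=> mf.
suff h : g_sigma_preimage (@rV_coord R n) `<=`
    [set A | measurable (f @^-1` A)].
  by move=> _ A mA; rewrite setTI; exact: h.
apply: smallest_sub.
  split=> [|A /= mA|F /= mF]; first by rewrite /= preimage_set0.
    by rewrite setTD preimage_setC; exact: measurableC.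
  by rewrite preimage_bigcup; exact: bigcup_measurable.
rewrite -bigcup_seq => A [i _ [B mB <-]] /=.
by rewrite setTI; have := mf i measurableT B mB; rewrite setTI.
Qed.


Definition rV_cons n (p : measurableTypeR R * 'rV[R]_n) : 'rV[R]_n.+1 :=
  row_mx (p.1 : R)%:M p.2.

Definition rV_uncons n (x : 'rV[R]_n.+1) : measurableTypeR R * 'rV[R]_n :=
  (rV_coord ord0 x, \row_i x ord0 (lift ord0 i)).

Lemma rV_consK n : cancel (@rV_cons n) (@rV_uncons n).
Proof.
move=> [t x]; rewrite /rV_uncons /rV_cons /rV_coord /=; congr pair.
  have -> : ord0 = lshift n (ord0 : 'I_1) by apply/val_inj.
  by rewrite (@row_mxEl _ 1 1 n) mxE.
apply/rowP => i; rewrite mxE.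
have -> : lift ord0 i = rshift 1 i by apply/val_inj.
by rewrite (@row_mxEr _ 1 1 n).
Qed.

Lemma measurable_rV_cons n : measurable_fun setT (@rV_cons n).
Proof.
apply: measurable_fun_rV => i.
have [j ->|->] := unliftP ord0 i.
  suff -> : rV_coord (lift ord0 j) \o @rV_cons n = rV_coord j \o snd.
    apply: measurableT_comp => //; exact: measurable_rV_coord.
  apply/funext => -[t x] /=; rewrite /rV_coord /rV_cons /=.
  have -> : lift ord0 j = rshift 1 j by apply/val_inj.
  by rewrite (@row_mxEr _ 1 1 n).
suff -> : rV_coord ord0 \o @rV_cons n = fst by exact: measurable_fst.
apply/funext => -[t x] /=; rewrite /rV_coord /rV_cons /=.
have -> : ord0 = lshift n (ord0 : 'I_1) by apply/val_inj.
by rewrite (@row_mxEl _ 1 1 n) mxE.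
Qed.

Lemma measurable_rV_uncons n : measurable_fun setT (@rV_uncons n).
Proof.
apply: measurable_fun_pair; first exact: measurable_rV_coord.
apply: measurable_fun_rV => i.
rewrite (_ : _ \o _ = rV_coord (lift ord0 i)); first exact: measurable_rV_coord.
by apply/funext => x /=; rewrite /rV_coord mxE.
Qed.

End rV_measurable_fun.

(* Lebesgue measure on R^(n+1) is the image of the product measure on R x R^n. *)
Section lebesgue_rV_step.
Context {R : realType} (n : nat).
Variable m : {sigma_finite_measure set 'rV[R]_n -> \bar R}.

Definition lebesgue_rV_step : set 'rV[R]_n.+1 -> \bar R :=
  pushforward (@lebesgue_measure R \x m)%E (@rV_cons R n).

Let step_measure : {measure set 'rV[R]_n.+1 -> \bar R} :=
  measure_function_pushforward__canonical__measure_function_Measure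
    (@lebesgue_measure R \x m)%E (@measurable_rV_cons R n).

HB.instance Definition _ := isMeasure.Build _ _ _ lebesgue_rV_step
  (measure0 step_measure) (measure_ge0 step_measure)
  (@measure_semi_sigma_additive _ _ _ step_measure).

Let step_sigma_finite : sigma_finite setT lebesgue_rV_step.
Proof.
have /sigma_finiteP[F [TF ndF Foo]] := sigma_finiteT (@lebesgue_measure R).
have /sigma_finiteP[G [TG ndG Goo]] := sigma_finiteT m.
exists (fun k => @rV_uncons R n @^-1` (F k `*` G k)).
  rewrite -preimage_bigcup; apply/esym; rewrite -subTset => x _.
  have : (\bigcup_k F k) (rV_uncons x).1 by rewrite -TF.
  have : (\bigcup_k G k) (rV_uncons x).2 by rewrite -TG.
  move=> [k _ Gk] [l _ Fl]; exists (maxn k l) => //; split.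
    by move: Fl; exact/subsetPset/ndF/leq_maxr.
  by move: Gk; exact/subsetPset/ndG/leq_maxl.
move=> k; have [mF Fk] := Foo k; have [mG Gk] := Goo k; split.
  rewrite -[X in measurable X]setTI.
  by apply: measurable_rV_uncons => //; exact: measurableX.
rewrite /lebesgue_rV_step /pushforward -comp_preimage.
rewrite (_ : _ \o _ = id); last first.
  by apply/funext => p /=; rewrite rV_consK.
rewrite preimage_id product_measure1E// lte_mul_pinfty// ge0_fin_numE//.
Qed.

HB.instance Definition _ := Measure_isSigmaFinite.Build _ _ _
  lebesgue_rV_step step_sigma_finite.

End lebesgue_rV_step.

Fixpoint lebesgue_rV {R : realType} (n : nat) :
    {sigma_finite_measure set 'rV[R]_n -> \bar R} :=
  match n with
  | 0 => dirac (0 : 'rV[R]_0)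
  | n'.+1 => lebesgue_rV_step (lebesgue_rV n')
  end.


(* The library norm `|x| on 'rV[R]_n is the sup norm; it induces the same
   topology, but |x - y| in the kernels below is the Euclidean length. *)
Section geometry.
Context {R : realType} {n : nat}.
Implicit Types (x y : 'rV[R]_n) (Om : set 'rV[R]_n).

Definition dot x y : R := \sum_(i < n) x ord0 i * y ord0 i.

Definition euclid x : R := Num.sqrt (dot x x).

Definition frontier Om : set 'rV[R]_n := closure Om `\` Om°.

(* Near each boundary point, [Om] is the strict epigraph, in some unit
   direction [e], of a Lipschitz function [phi] on the hyperplane orthogonal
   to [e]: [y - dot y e *: e] is the orthogonal projection of [y] on it. *)
Definition lipschitz_boundary Om : Prop :=
  forall x, frontier Om x ->
  exists (e : 'rV[R]_n) (phi : 'rV[R]_n -> R) (L r : R),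
  [/\ euclid e = 1, 0 < r,
      forall y z, `|phi y - phi z| <= L * euclid (y - z) &
      forall y, euclid (y - x) < r ->
        (Om y <-> phi (y - dot y e *: e) < dot y e)].

Definition bounded_lipschitz_domain Om : Prop :=
  [/\ open Om, connected Om, Om !=set0, bounded_set Om & lipschitz_boundary Om].

(* Points of R^n are given as the rows of a matrix. *)
Definition affinely_independent k (V : 'M[R]_(k, n)) : bool :=
  row_free (row_mx (const_mx 1 : 'cV[R]_k) V).

(* Convex hull of the rows of [V] whose index is in [I]. *)
Definition face k (V : 'M[R]_(k, n)) (I : {set 'I_k}) : set 'rV[R]_n :=
  [set x | exists l : 'rV[R]_k,
     [/\ forall i, 0 <= l ord0 i, forall i, i \notin I -> l ord0 i = 0,
         \sum_i l ord0 i = 1 & x = l *m V]].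

Definition hull k (V : 'M[R]_(k, n)) : set 'rV[R]_n := face V [set: 'I_k].

(* The boundary is a finite union of (n-1)-dimensional simplices. *)
Definition polygonal_boundary Om : Prop :=
  exists s : seq 'M[R]_(n, n),
    (forall V, V \in s -> affinely_independent V) /\
    frontier Om = \bigcup_(V in [set` s]) hull V.

(* Conforming triangulations by n-dimensional simplices: any two simplices
   meet in a common (possibly empty) face. *)
Definition triangulation Om (Th : seq 'M[R]_(n.+1, n)) : Prop :=
  [/\ forall T, T \in Th -> affinely_independent T,
      closure Om = \bigcup_(T in [set` Th]) hull T &
      forall T T', T \in Th -> T' \in Th ->
        exists I I', hull T `&` hull T' = face T I /\ face T I = face T' I'].

Definition simplex_diam (T : 'M[R]_(n.+1, n)) : R :=
  sup [set d | exists x y, [/\ hull T x, hull T y & d = euclid (x - y)]].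

(* Diameter of the largest ball contained in the simplex. *)
Definition simplex_indiam (T : 'M[R]_(n.+1, n)) : R :=
  sup [set d | exists (c : 'rV[R]_n) (r : R),
    [/\ 0 <= r, d = 2 * r & forall y, euclid (y - c) <= r -> hull T y]].

Definition shape_regular (kappa : R) (Th : seq 'M[R]_(n.+1, n)) : Prop :=
  forall T, T \in Th -> simplex_diam T <= kappa * simplex_indiam T.

End geometry.


(* Elements of the spaces below are represented by functions on the whole of
   R^n; only their values on [Om] matter. *)
Section sobolev.
Context {R : realType} {n : nat}.
Variables (s : R) (Om : set 'rV[R]_n).
Implicit Types u v w g : 'rV[R]_n -> R.

Local Notation mu := (@lebesgue_rV R n).

Definition frac_kernel (z : 'rV[R]_n * 'rV[R]_n) : R :=
  (euclid (z.1 - z.2) `^ (n%:R + 2 * s))^-1.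

Definition L2_norm v : \bar R := 'N[mu]_2%:E[EFin \o (v \_ Om)].

Definition Hs_seminorm v : \bar R :=
  ((\int[(mu \x mu)%E]_(z in Om `*` Om)
      ((v z.1 - v z.2) ^+ 2 * frac_kernel z)%:E) `^ 2^-1)%E.

Definition Hs_norm v : \bar R := (L2_norm v + Hs_seminorm v)%E.

Definition Hs : set ('rV[R]_n -> R) :=
  [set v | measurable_fun Om v /\ (Hs_norm v < +oo)%E].

Fixpoint C_k (k : nat) v : Prop :=
  continuous v /\
  if k is k'.+1 then
    forall i : 'I_n, (forall x, derivable v x (delta_mx ord0 i)) /\
                     C_k k' (fun x => 'D_(delta_mx ord0 i) v x)
  else True.

Definition C_infty v : Prop := forall k, C_k k v.

(* Functions in C^oo(closure Om) are the restrictions of smooth functions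
   on R^n. *)
Definition Hs0 : set ('rV[R]_n -> R) :=
  [set v | Hs v /\ forall eps : R, 0 < eps -> exists phi,
     [/\ C_infty phi, forall x, frontier Om x -> phi x = 0 &
         (Hs_norm (v \- phi)%R < eps%:E)%E]].

(* Elements of the dual H^{-s} of H^s_0, as real functions of a
   representative. *)
Implicit Types L : ('rV[R]_n -> R) -> R.

Definition dual_norm L : \bar R :=
  ereal_sup [set `|L v|%:E | v in [set v | Hs0 v /\ (Hs_norm v <= 1)%E]].

Definition Hs_dual : set (('rV[R]_n -> R) -> R) :=
  [set L | (forall (k : R) v w, Hs0 v -> Hs0 w ->
              L (fun x => k * v x + w x) = k * L v + L w) /\
           (dual_norm L < +oo)%E].

Definition pairing g v : R := \int[mu]_(x in Om) (g x * v x).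


Definition Gamma (t : R) : R :=
  \int[@lebesgue_measure R]_(x in `]0, +oo[) (x `^ (t - 1) * expR (- x)).

Definition c_ns : R :=
  2 `^ (2 * s) * s * Gamma ((n%:R + 2 * s) / 2) /
  (pi `^ (n%:R / 2) * Gamma (1 - s)).

Definition a_domain : set ('rV[R]_n * 'rV[R]_n) :=
  (Om `*` setT) `|` (setT `*` Om).

(* [u \_ Om] is the extension of [u] by 0 outside [Om]. *)
Definition a_integrand u v (z : 'rV[R]_n * 'rV[R]_n) : R :=
  ((u \_ Om) z.1 - (u \_ Om) z.2) * ((v \_ Om) z.1 - (v \_ Om) z.2) *
  frac_kernel z.

Definition a_form u v : R :=
  c_ns / 2 * \int[(mu \x mu)%E]_(z in a_domain) a_integrand u v z.

Definition a_continuous : Prop :=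
  (forall u v, Hs0 u -> Hs0 v ->
     (mu \x mu)%E.-integrable a_domain (EFin \o a_integrand u v)) /\
  exists M : R, forall u v, Hs0 u -> Hs0 v ->
     (`|a_form u v|%:E <= M%:E * Hs_norm u * Hs_norm v)%E.

Definition a_coercive : Prop :=
  exists2 alpha : R, 0 < alpha &
    forall v, Hs0 v -> (alpha%:E * Hs_norm v ^+ 2 <= (a_form v v)%:E)%E.

Definition fracLap u : ('rV[R]_n -> R) -> R := fun v => a_form u v.


Definition V_h (Th : seq 'M[R]_(n.+1, n)) : set ('rV[R]_n -> R) :=
  [set v | [/\ Hs0 v, {within closure Om, continuous v},
     forall T, T \in Th -> exists (w : 'rV[R]_n) (c : R),
       forall x, hull T x -> v x = dot w x + c &
     forall x, frontier Om x -> v x = 0]].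

Definition Linfty : set ('rV[R]_n -> R) :=
  [set g | measurable_fun Om g /\ ('N[mu]_+oo[EFin \o (g \_ Om)] < +oo)%E].

Definition friction (S : set 'rV[R]_n) (F v : 'rV[R]_n -> R) : R :=
  \int[mu]_(x in S) (F x * `|v x|).

End sobolev.

(* Main.v *)
Require Import Defs.
From HB Require Import structures.
From mathcomp Require Import all_boot all_order all_algebra.
From mathcomp Require Import all_classical all_reals all_analysis.
From mathcomp Require Import measurable_realfun ess_sup_inf.
From mathcomp Require Import ring lra.

(** Let [e = u - uh]. Coercivity bounds [alpha |e|^2] by [a(e, e) = <rh -
    sigmah, e> + <sigmah - sigma, e>]. The first term is at most [|rh -
    sigmah|_{-s} |e|]. For the second one, the inequality of [u] tested
    with [uh] reads [<sigma, uh - u> <= j(uh) - j(u)], whence [<sigmah -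
    sigma, e> <= <sigmah, u - uh> + j(uh) - j(u)]; this is a comparison of
    integrals whose integrands satisfy a pointwise inequality
    ([friction_pointwise]), and it gives [<sigmah - sigma, e> <=
    <excess^+, |e|> + X], where [X >= 0] is the non-quadratic part of the
    right-hand side ([friction_integrated]). Young's inequality concludes
    ([quadratic_absorption]); the bound on [sigma - sigmah] follows,
    because this functional is the difference of [rh - sigmah] and of
    [a(e, v)] as a function of [v], which is continuous.

    The delicate point is [<excess^+, |e|> <= |excess^+|_{-s} |e|], as the
    dual norm only tests functions in the closure of the smooth functions
    vanishing on the boundary. Membership of [|e|] in that closure can be
    bypassed: if [phi] is smooth, vanishes on the boundary and is close to
    [e], then [psi = sqrt (phi^2 + delta^2) - delta] is smooth, vanishes
    on the boundary, has at most the [H^s] norm of [phi] since [t |-> sqrt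
    (t^2 + delta^2) - delta] is 1-Lipschitz and fixes [0], and is close to
    [|e|] in [L^2] ([pairing_abs_le]). As all functions at hand are in
    [L^2], this suffices to pass to the limit in the pairing.

    What remains is groundwork: open sets of [R^n] are measurable and
    bounded ones have finite measure, the [C^k] functions are closed under
    the operations used above, and the norm of [H^s] is the sum of the
    [L^2] norms of the function and of its weighted difference quotient,
    so that it inherits the triangle inequality and homogeneity from
    [L^2]. *)

Set Implicit Arguments.
Unset Strict Implicit.
Unset Printing Implicit Defensive.

Import Order.TTheory GRing.Theory Num.Theory.
Import numFieldNormedType.Exports.

Local Open Scope classical_set_scope.
Local Open Scope ring_scope.

(** * Borel sets and Lebesgue measure of R^n *)

Section rV_borel.
Context {R : realType}.

Lemma measurable_box n (B : 'I_n -> set R) : (forall i, measurable (B i)) ->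
  measurable [set x : 'rV[R]_n | forall i, B i (x ord0 i)].
Proof.
move=> mB.
have -> : [set x : 'rV[R]_n | forall i, B i (x ord0 i)] =
    \big[setI/setT]_(i < n) (rV_coord i @^-1` B i).
  apply/seteqP; split => [x xp|x].
    by apply: (@big_ind _ (fun A : set _ => A x)) => [|? ? ? ?|i _] //;
      exact: xp.
  by move=> + i; rewrite (bigD1 i)//= => -[+ _].
apply: bigsetI_measurable => i _.
by rewrite -[X in measurable X]setTI; apply: measurable_rV_coord => //;
  exact: mB.
Qed.

Let coord_ball n (p : 'rV[rat]_n * nat) : set 'rV[R]_n :=
  [set x | forall i, ball (ratr (p.1 ord0 i) : R) p.2.+1%:R^-1 (x ord0 i)].

(** The sigma-algebra is generated by the coordinates, not by the open
    sets: an open set is the union of the countably many cubes with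
    rational centre and radius [1 / k.+1] that it contains. *)
Lemma open_measurable_rV n (U : set 'rV[R]_n) : open U -> measurable U.
Proof.
move=> oU.
have -> : U = \bigcup_(p : {p | `[< coord_ball p `<=` U >]}) coord_ball (val p).
  apply/seteqP; split => [x Ux|x [[p pU] _]]; last exact: (asboolW pU).
  have /nbhs_ballP[e /= e0 xeU] : nbhs x U by exact: open_nbhs_nbhs.
  have e20 : 0 < e / 2 by rewrite divr_gt0.
  have [k _ /(_ k (leqnn k)) /= ke] := near_infty_natSinv_lt (PosNum e20).
  pose c : R := k.+1%:R^-1; have c0 : 0 < c by rewrite invr_gt0.
  have /choice[q xq] : forall i : 'I_n, exists q : rat,
      ball (ratr q : R) c (x ord0 i).
    move=> i; have [|q] := @rat_in_itvoo R (x ord0 i - c) (x ord0 i + c).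
      lra.
    by rewrite in_itv/= => /andP[? ?]; exists q;
      rewrite /ball/= ltr_norml; apply/andP; split; lra.
  have xp : coord_ball (\row_i q i, k) x by move=> i /=; rewrite mxE; exact: xq.
  have pU : coord_ball (\row_i q i, k) `<=` U.
    move=> y yp; apply: xeU; split => // i j; rewrite (ord1 i) /ball /=.
    have := ler_distD (ratr (q j)) (x ord0 j) (y ord0 j).
    have := xq j; have := yp j; rewrite /ball /= mxE -/c.
    rewrite (distrC (x ord0 j) (ratr _)).
    move: ke; rewrite -/c; lra.
  by exists (exist (fun p => `[< coord_ball p `<=` U >]) (\row_i q i, k)
    (asboolT pU)).
apply: countable_bigcupT_measurable => [|p]; first exact: countableP.
apply: (@measurable_box n (fun i =>
  ball (ratr ((val p).1 ord0 i) : R) (val p).2.+1%:R^-1)) => i.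
apply: open_measurable.
exact: (@ball_open R R).
Qed.

Lemma continuous_measurable_rV n (f : 'rV[R]_n -> R) :
  continuous f -> measurable_fun setT f.
Proof.
move=> /continuousP cf; apply: (measurability _ (RGenOpens.measurableE R)).
move=> _ [_ [a [b ->] <-]]; rewrite setTI; apply: open_measurable_rV.
exact/cf/interval_open.
Qed.

Let cube n (M : R) : set 'rV[R]_n := [set x | forall i, x ord0 i \in `[- M, M]].

Let cubeS n M :
  @rV_cons R n @^-1` @cube n.+1 M = `[- M, M]%classic `*` @cube n M.
Proof.
apply/seteqP; split => [[t x] /= h|[t x] [/= ht hx] i].
  split => /=.
    have := h ord0; rewrite /rV_cons/=.
    have -> : ord0 = lshift n (ord0 : 'I_1) by apply/val_inj.
    by rewrite (@row_mxEl _ 1 1 n) mxE.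
  move=> i; have := h (lift ord0 i); rewrite /rV_cons/=.
  have -> : lift ord0 i = rshift 1 i by apply/val_inj.
  by rewrite (@row_mxEr _ 1 1 n).
have [j ->|->] := unliftP ord0 i; rewrite /rV_cons/=.
  have -> : lift ord0 j = rshift 1 j by apply/val_inj.
  by rewrite (@row_mxEr _ 1 1 n).
have -> : ord0 = lshift n (ord0 : 'I_1) by apply/val_inj.
by rewrite (@row_mxEl _ 1 1 n) mxE.
Qed.

Let measurable_cube n M : measurable (@cube n M).
Proof. by apply: (@measurable_box n (fun=> `[- M, M]%classic)) => i. Qed.

Let cube_lty n M : (lebesgue_rV n (@cube n M) < +oo)%E.
Proof.
elim: n => [|n IHn]; first by rewrite /= diracE ltry.
rewrite /= /lebesgue_rV_step /pushforward cubeS product_measure1E//;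
  last exact: measurable_cube.
have fin : lebesgue_measure (`[- M, M]%classic : set R) \is a fin_num.
  by rewrite lebesgue_measure_itv /=; case: ifP.
by rewrite lte_mul_pinfty.
Qed.

Lemma bounded_lebesgue_rV n (A : set 'rV[R]_n) :
  measurable A -> bounded_set A -> (lebesgue_rV n A < +oo)%E.
Proof.
move=> mA [M [_ /(_ (M + 1))]]; rewrite ltrDl => /(_ ltr01) AM.
apply: (le_lt_trans _ (@cube_lty n (M + 1))).
apply: le_measure; rewrite ?inE//; first exact: measurable_cube.
move=> x Ax i; rewrite in_itv /= -ler_norml; apply: (le_trans _ (AM x Ax)).
rewrite [leRHS]mx_normrE.
exact: (le_bigmax _ (fun ij : _ * _ => `|x ij.1 ij.2|) (ord0, i)).
Qed.

End rV_borel.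

(** * Smooth functions and a smooth absolute value *)

Section smooth.
Context {R : realType} {n : nat}.
Implicit Types (f g phi : 'rV[R]_n -> R).

Let deriveE1 f x v : 'D_v f x = 'D_1 (fun h : R => f (h *: v + x)) 0.
Proof.
rewrite /derive; set g1 := (X in lim (X @ _)); set g2 := (X in _ = lim (X @ _)).
suff -> : g1 = g2 by [].
by apply/funext => h; rewrite /g1 /g2 /= addr0 scale0r add0r [_%:A]mulr1.
Qed.

(** A directional derivative is a derivative of one variable along a line,
    to which the one-dimensional chain rule applies. *)
Lemma is_derive_comp (F : R -> R) g x v a b :
  is_derive (g x) 1 F a -> is_derive x v g b -> is_derive x v (F \o g) (a * b).
Proof.
move=> dF [/derivable1P dg gb].
have dg0 : is_derive (0 : R) 1 (fun h : R => g (h *: v + x)) b.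
  by apply: DeriveDef; rewrite // -gb deriveE1.
have dF0 : is_derive (g (0 *: v + x)) 1 F a by rewrite scale0r add0r.
have [dFg Fgb] := is_derive1_comp dF0 dg0.
apply: DeriveDef; first exact/derivable1P.
by rewrite deriveE1 -Fgb.
Qed.

Lemma C_k_le k f : C_k k.+1 f -> C_k k f.
Proof.
elim: k f => [|k IHk] f [cf Df]; split => // i.
by have [df /IHk] := Df i.
Qed.

Lemma C_kS k f (df : 'I_n -> 'rV[R]_n -> R) : continuous f ->
  (forall i x, is_derive x (delta_mx ord0 i) f (df i x)) ->
  (forall i, C_k k (df i)) -> C_k k.+1 f.
Proof.
move=> cf fdf dfk; split => // i; split => [x|]; first by have [] := fdf i x.
suff -> : (fun x => 'D_(delta_mx ord0 i) f x) = df i by exact: dfk.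
by apply/funext => x; have [] := fdf i x.
Qed.

Lemma C_k_cst k (c : R) : C_k k (fun _ : 'rV[R]_n => c).
Proof.
elim: k c => [|k IHk] c; first by split => // x; exact: (@cst_continuous _ _ c).
by apply: (@C_kS _ _ (fun _ _ => 0) (@cst_continuous _ _ c)) => i.
Qed.

Lemma C_k_continuous k f : C_k k f -> continuous f.
Proof. by case: k => [|k] []. Qed.

Lemma C_k_is_derive k f i x : C_k k.+1 f ->
  is_derive x (delta_mx ord0 i) f ('D_(delta_mx ord0 i) f x).
Proof. by move=> [_ /(_ i)[df _]]; exact: derivableP. Qed.

Lemma C_k_derive k f i :
  C_k k.+1 f -> C_k k (fun x => 'D_(delta_mx ord0 i) f x).
Proof. by move=> [_ /(_ i)[]]. Qed.

Lemma C_kD k f g : C_k k f -> C_k k g -> C_k k (fun x => f x + g x).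
Proof.
have cD f' g' : continuous f' -> continuous g' ->
    continuous (fun x => f' x + g' x).
  by move=> cf cg x; apply: (@continuousD _ _ _ f' g'); [exact: cf|exact: cg].
elim: k f g => [|k IHk] f g fk gk.
  by split => //; exact: (cD _ _ (C_k_continuous fk) (C_k_continuous gk)).
apply: (@C_kS _ _ (fun i x =>
  'D_(delta_mx ord0 i) f x + 'D_(delta_mx ord0 i) g x)) => [|i x|i].
- by exact: (cD _ _ (C_k_continuous fk) (C_k_continuous gk)).
- exact: is_deriveD (C_k_is_derive i x fk) (C_k_is_derive i x gk).
- by apply: IHk; exact: C_k_derive.
Qed.

Lemma C_kM k f g : C_k k f -> C_k k g -> C_k k (fun x => f x * g x).
Proof.
have cM f' g' : continuous f' -> continuous g' ->
    continuous (fun x => f' x * g' x).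
  by move=> cf cg x; apply: (@continuousM _ _ f' g'); [exact: cf|exact: cg].
elim: k f g => [|k IHk] f g fk gk.
  by split => //; exact: (cM _ _ (C_k_continuous fk) (C_k_continuous gk)).
apply: (@C_kS _ _ (fun i x =>
  f x * 'D_(delta_mx ord0 i) g x + g x * 'D_(delta_mx ord0 i) f x)) => [|i x|i].
- by exact: (cM _ _ (C_k_continuous fk) (C_k_continuous gk)).
- exact: is_deriveM (C_k_is_derive i x fk) (C_k_is_derive i x gk).
- by apply: C_kD; apply: IHk; by [exact: C_k_le|exact: C_k_derive].
Qed.

Lemma C_kZ k (c : R) f : C_k k f -> C_k k (fun x => c * f x).
Proof. by apply: C_kM; exact: C_k_cst. Qed.

(** The derivatives of [sqrt f] and of its inverse are polynomials in the
    latter and in the derivatives of [f], so that the regularity of the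
    two functions is proved jointly. *)
Lemma C_k_sqrt k f : (forall x, 0 < f x) -> C_k k f ->
  C_k k (fun x => Num.sqrt (f x)) /\ C_k k (fun x => (Num.sqrt (f x))^-1).
Proof.
move=> f0; have sf0 x : Num.sqrt (f x) != 0 by rewrite gt_eqF// sqrtr_gt0.
have csv : continuous f -> continuous (fun x => Num.sqrt (f x)) /\
    continuous (fun x => (Num.sqrt (f x))^-1).
  move=> cf; have cs : continuous (fun x => Num.sqrt (f x)).
    by move=> x; apply: continuous_comp; [exact: cf|exact: sqrt_continuous].
  by split => // x; exact: (cvgV (sf0 x) (cs x)).
elim: k => [|k IHk] fk; have [cs cv] := csv (C_k_continuous fk); first by [].
have [sk vk] := IHk (C_k_le fk).
pose ds i x := 2^-1 * (Num.sqrt (f x))^-1 * 'D_(delta_mx ord0 i) f x.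
have Ds i x : is_derive x (delta_mx ord0 i) (fun x => Num.sqrt (f x)) (ds i x).
  rewrite /ds -invfM; apply: (@is_derive_comp Num.sqrt f).
    exact: is_derive1_sqrt.
  exact: C_k_is_derive fk.
have dsk i : C_k k (ds i) by apply: C_kM; [exact: C_kZ|exact: C_k_derive].
split; first exact: (@C_kS _ _ ds).
apply: (@C_kS _ _ (fun i x =>
  -1 * ((Num.sqrt (f x))^-1 * (Num.sqrt (f x))^-1 * ds i x))) => // [i x|i].
  have [dsx dsE] := Ds i x; apply: DeriveDef; first exact: derivableV.
  by rewrite deriveV// dsE mulN1r -invfM -expr2 -mulNr.
by apply: C_kZ; apply: C_kM => //; exact: C_kM.
Qed.

Definition smooth_abs (delta : R) (t : R) :=
  Num.sqrt (t ^+ 2 + delta ^+ 2) - delta.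

Lemma C_infty_smooth_abs delta f : 0 < delta -> C_infty f ->
  C_infty (smooth_abs delta \o f).
Proof.
move=> d0 fk k; have fk' := fk k.
rewrite (_ : _ \o _ = fun x => Num.sqrt (f x * f x + delta ^+ 2) + - delta)//.
pose h x := f x * f x + delta ^+ 2.
have h0 x : 0 < h x by rewrite /h -expr2 ltr_wpDl ?sqr_ge0 ?exprn_gt0.
have hk : C_k k h by apply: C_kD; [exact: C_kM|exact: C_k_cst].
by apply: C_kD; [exact: (C_k_sqrt h0 hk).1|exact: C_k_cst].
Qed.

Lemma smooth_abs0 delta : 0 <= delta -> smooth_abs delta 0 = 0.
Proof.
by move=> d0; rewrite /smooth_abs expr0n add0r sqrtr_sqr ger0_norm ?subrr.
Qed.

(** With [a] and [b] the two square roots, [(a - b) (a + b) = (t - u) (t +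
    u)], and [a + b] exceeds [|t + u|]. *)
Lemma smooth_abs_lip delta t u : 0 < delta ->
  `|smooth_abs delta t - smooth_abs delta u| <= `|t - u|.
Proof.
move=> d0; rewrite /smooth_abs opprB addrA subrK.
set a := Num.sqrt (t ^+ 2 + _); set b := Num.sqrt (u ^+ 2 + _).
have sq (x : R) : `|x| < Num.sqrt (x ^+ 2 + delta ^+ 2).
  have d20 : 0 < delta ^+ 2 by rewrite exprn_gt0.
  by rewrite -sqrtr_sqr ltr_sqrt ?ltrDl// ltr_wpDl ?sqr_ge0.
have at0 : `|t| < a := sq t; have bu0 : `|u| < b := sq u.
have ab0 : 0 < a + b.
  by rewrite addr_gt0// ?(le_lt_trans _ at0) ?(le_lt_trans _ bu0).
have E : (a - b) * (a + b) = (t - u) * (t + u).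
  have : a ^+ 2 = t ^+ 2 + delta ^+ 2 by rewrite sqr_sqrtr// addr_ge0 ?sqr_ge0.
  have : b ^+ 2 = u ^+ 2 + delta ^+ 2 by rewrite sqr_sqrtr// addr_ge0 ?sqr_ge0.
  lra.
rewrite -(ler_pM2r ab0) -[in leLHS](gtr0_norm ab0) -normrM E normrM.
by rewrite ler_wpM2l// (le_trans (ler_normD _ _))// ltW// ltrD.
Qed.

Lemma smooth_abs_near delta t : 0 <= delta ->
  `| `|t| - smooth_abs delta t| <= delta.
Proof.
move=> d0; rewrite /smooth_abs.
have lo : `|t| <= Num.sqrt (t ^+ 2 + delta ^+ 2).
  by rewrite -sqrtr_sqr ler_wsqrtr// lerDl sqr_ge0.
have hi : Num.sqrt (t ^+ 2 + delta ^+ 2) <= `|t| + delta.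
  rewrite -[leRHS]ger0_norm ?addr_ge0// -sqrtr_sqr ler_wsqrtr// sqrrD.
  have := mulr_ge0 (normr_ge0 t) d0; rewrite real_normK ?num_real// mulr2n; lra.
by rewrite ler_norml; apply/andP; split; lra.
Qed.

End smooth.

(** * The norm of H^s *)

Section Lnorm2.
Context d {T : measurableType d} {R : realType}.
Variable m : {measure set T -> \bar R}.
Implicit Types f g : T -> R.

Lemma measurable_abse_sq f : measurable_fun setT f ->
  measurable_fun setT (fun x => (`|(f x)%:E| `^ 2)%E).
Proof.
move=> mf; apply: (@measurableT_comp _ _ _ _ _ _ (fun x => (x `^ 2)%E)) => //.
  exact: measurable_poweR.
by apply: measurableT_comp => //; exact/measurable_EFinP.
Qed.

Lemma le_Lnorm2 f g : measurable_fun setT f -> measurable_fun setT g ->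
  (forall x, `|f x| <= `|g x|) ->
  ('N[m]_2%:E[EFin \o f] <= 'N[m]_2%:E[EFin \o g])%E.
Proof.
move=> mf mg fg; rewrite unlock.
have i0 h : (0 <= \int[m]_x `|(h x)%:E| `^ 2)%E.
  by apply: integral_ge0 => x _; exact: poweR_ge0.
apply: gt0_ler_poweR => //; rewrite ?in_itv/= ?leey ?i0//.
apply: ge0_le_integral => //; try exact: measurable_abse_sq.
by move=> x _; rewrite lee_fin ge0_ler_powR// nnegrE.
Qed.

Lemma Lnorm2Z (k : R) f : measurable_fun setT f ->
  ('N[m]_2%:E[EFin \o (fun x => k * f x)%R] =
   `|k|%:E * 'N[m]_2%:E[EFin \o f])%E.
Proof.
move=> mf; rewrite unlock.
under eq_integral do rewrite /= normrM powRM// EFinM.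
rewrite ge0_integralZl_EFin//; last exact: measurable_abse_sq.
rewrite poweRM ?integral_ge0 ?lee_fin ?powR_ge0// poweR_EFin -powRrM divff//.
by rewrite powRr1.
Qed.

Lemma Lnorm2_lincomb (k : R) f g :
  measurable_fun setT f -> measurable_fun setT g ->
  ('N[m]_2%:E[EFin \o (fun x => k * f x + g x)%R] <=
   `|k|%:E * 'N[m]_2%:E[EFin \o f] + 'N[m]_2%:E[EFin \o g])%E.
Proof.
move=> mf mg; rewrite -Lnorm2Z//.
apply: (@eminkowski _ _ _ _ (fun x => k * f x)%R g) => //.
  exact: measurable_funM.
by rewrite lee_fin ler1n.
Qed.

End Lnorm2.

Section frac_kernel.
Context {R : realType} {n : nat}.
Variable s : R.

Lemma frac_kernel_ge0 (z : 'rV[R]_n * 'rV[R]_n) : 0 <= frac_kernel s z.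
Proof. by rewrite invr_ge0 powR_ge0. Qed.

Lemma measurable_frac_kernel :
  measurable_fun setT (frac_kernel s : 'rV[R]_n * 'rV[R]_n -> R).
Proof.
rewrite (_ : frac_kernel s =
    fun z : 'rV[R]_n * 'rV[R]_n => euclid (z.1 - z.2) `^ (- (n%:R + 2 * s)));
  last by apply/funext => z; rewrite powRN.
apply: (@measurableT_comp _ _ _ _ _ _ (@powR R ^~ _)) => //.
apply: (@measurableT_comp _ _ _ _ _ _ (@Num.sqrt R)).
  exact: continuous_measurable_fun (@sqrt_continuous R).
apply: measurable_sum => i.
suff md : measurable_fun setT
    (fun z : 'rV[R]_n * 'rV[R]_n => (z.1 - z.2) ord0 i).
  exact: measurable_funM.
rewrite (_ : (fun z => _) = fun z => rV_coord i z.1 - rV_coord i z.2);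
  last by apply/funext => z; rewrite !mxE.
apply: measurable_funB; apply: (measurableT_comp (measurable_rV_coord i)).
  exact: measurable_fst.
exact: measurable_snd.
Qed.

End frac_kernel.

Section Hs.
Context {R : realType} {n : nat}.
Variables (s : R) (Om : set 'rV[R]_n).
Hypothesis mOm : measurable Om.
Implicit Types u v w g : 'rV[R]_n -> R.
Local Notation mu := (@lebesgue_rV R n).

(** The seminorm of [v] is the [L^2] norm of this function on [Om `*` Om],
    which is linear in [v]. *)
Definition diff_quot v (z : 'rV[R]_n * 'rV[R]_n) : R :=
  (v z.1 - v z.2) * Num.sqrt (frac_kernel s z).

Lemma Hs_normE v : Hs_norm s Om v =
  ('N[mu]_2%:E[EFin \o (v \_ Om)] +
   'N[(mu \x mu)%E]_2%:E[EFin \o (diff_quot v \_ (Om `*` Om))])%E.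
Proof.
congr (_ + _)%E; rewrite /Hs_seminorm unlock; congr (_ `^ _)%E.
rewrite [LHS]integral_mkcond; apply: eq_integral => z _.
rewrite /= /patch; case: ifPn => _; last by rewrite normr0 powR0.
rewrite powR_mulrn// -normrX exprMn sqr_sqrtr ?frac_kernel_ge0//.
by rewrite ger0_norm// mulr_ge0 ?sqr_ge0 ?frac_kernel_ge0.
Qed.

Lemma measurable_diff_quot v : measurable_fun Om v ->
  measurable_fun setT (diff_quot v \_ (Om `*` Om)).
Proof.
move=> mv; apply/(measurable_restrictT _ (measurableX mOm mOm)).
have mfst : measurable_fun (Om `*` Om) (fun z : 'rV[R]_n * 'rV[R]_n => v z.1).
  apply: (measurable_comp mOm _ mv (measurable_funTS measurable_fst)).
  by move=> _ [z [? _] <-].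
have msnd : measurable_fun (Om `*` Om) (fun z : 'rV[R]_n * 'rV[R]_n => v z.2).
  apply: (measurable_comp mOm _ mv (measurable_funTS measurable_snd)).
  by move=> _ [z [_ ?] <-].
apply: measurable_funM; first exact: measurable_funB.
apply: measurable_funTS.
apply: (@measurableT_comp _ _ _ _ _ _ (@Num.sqrt R)).
  exact: continuous_measurable_fun (@sqrt_continuous R).
exact: measurable_frac_kernel.
Qed.

Lemma Hs_norm_ge0 v : (0 <= Hs_norm s Om v)%E.
Proof. by rewrite Hs_normE adde_ge0// Lnorm_ge0. Qed.

(** The hypotheses hold when [v] is the composition of [w] with a
    1-Lipschitz map fixing [0]: such maps do not increase the norm. *)
Lemma le_Hs_norm v w : measurable_fun Om v -> measurable_fun Om w ->
  (forall x, `|v x| <= `|w x|) -> (forall x y, `|v x - v y| <= `|w x - w y|) ->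
  (Hs_norm s Om v <= Hs_norm s Om w)%E.
Proof.
move=> mv mw vw dvw; rewrite !Hs_normE; apply: leeD; apply: le_Lnorm2.
- exact/(measurable_restrictT _ mOm).
- exact/(measurable_restrictT _ mOm).
- by move=> x; rewrite /patch; case: ifP.
- exact: measurable_diff_quot.
- exact: measurable_diff_quot.
- by move=> z; rewrite /patch; case: ifP => // _; rewrite !normrM ler_wpM2r.
Qed.

Lemma Hs_norm_lincomb (k : R) v w :
  measurable_fun Om v -> measurable_fun Om w ->
  (Hs_norm s Om (fun x => k * v x + w x)%R <=
   `|k|%:E * Hs_norm s Om v + Hs_norm s Om w)%E.
Proof.
move=> mv mw; rewrite !Hs_normE ge0_muleDr ?Lnorm_ge0// addeACA.
apply: leeD.
  rewrite (_ : _ \_ Om = fun x => k * (v \_ Om) x + (w \_ Om) x).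
    by apply: Lnorm2_lincomb; exact/(measurable_restrictT _ mOm).
  by apply/funext => x; rewrite /patch; case: ifP => // _; rewrite mulr0 addr0.
rewrite (_ : diff_quot _ \_ _ = fun z => k * (diff_quot v \_ (Om `*` Om)) z +
    (diff_quot w \_ (Om `*` Om)) z).
  by apply: Lnorm2_lincomb; exact: measurable_diff_quot.
apply/funext => z; rewrite /patch; case: ifP => // _; last first.
  by rewrite mulr0 addr0.
by rewrite /diff_quot; ring.
Qed.

Lemma Hs_normZ (k : R) v : measurable_fun Om v ->
  Hs_norm s Om (fun x => k * v x) = (`|k|%:E * Hs_norm s Om v)%E.
Proof.
move=> mv; rewrite !Hs_normE ge0_muleDr ?Lnorm_ge0//; congr (_ + _)%E.
  rewrite -Lnorm2Z; last exact/(measurable_restrictT _ mOm).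
  by apply: eq_Lnorm => x /=; rewrite /patch; case: ifP => // _; rewrite mulr0.
rewrite -Lnorm2Z; last exact: measurable_diff_quot.
apply: eq_Lnorm => z /=; congr EFin; rewrite /patch.
by case: ifP => _; rewrite ?mulr0// /diff_quot; ring.
Qed.

Lemma Hs_lincomb (k : R) v w :
  Hs s Om v -> Hs s Om w -> Hs s Om (fun x => k * v x + w x).
Proof.
move=> [mv vfin] [mw wfin]; split.
  by apply: measurable_funD => //; exact: measurable_funM.
apply: le_lt_trans (Hs_norm_lincomb k mv mw) _.
by rewrite lte_add_pinfty// lte_mul_pinfty ?lee_fin.
Qed.

Lemma C_infty_measurable v : C_infty v -> measurable_fun Om v.
Proof.
move=> /(_ 0) [cv _]; apply: measurable_funTS.
exact: continuous_measurable_rV.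
Qed.

Lemma Hs_norm0 : Hs_norm s Om (fun=> 0) = 0%E.
Proof.
rewrite Hs_normE.
have -> : (fun=> 0) \_ Om = cst 0 :> ('rV[R]_n -> R).
  by apply/funext => x; rewrite /patch; case: ifP.
have -> : diff_quot (fun=> 0) \_ (Om `*` Om) = cst 0.
  by apply/funext => z; rewrite /patch /diff_quot subrr mul0r; case: ifP.
by rewrite !Lnorm0 ?adde0// eqe.
Qed.

Lemma Hs0_smooth v : C_infty v -> (forall x, frontier Om x -> v x = 0) ->
  (Hs_norm s Om v < +oo)%E -> Hs0 s Om v.
Proof.
move=> cv v0 vfin; split; first by split => //; exact: C_infty_measurable.
move=> e e0; exists v; split => //.
rewrite (_ : v \- v = fun=> 0) ?Hs_norm0 ?lte_fin//.
by apply/funext => x /=; rewrite subrr.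
Qed.

Lemma Hs0_0 : Hs0 s Om (fun=> 0).
Proof.
by apply: Hs0_smooth => //; [move=> k; exact: C_k_cst|rewrite Hs_norm0 ltry].
Qed.

Lemma Hs0_lincomb (k : R) v w :
  Hs0 s Om v -> Hs0 s Om w -> Hs0 s Om (fun x => k * v x + w x).
Proof.
move=> [Hv v_] [Hw w_]; split; first exact: Hs_lincomb.
move=> e e0.
have k1 : 0 < `|k| + 1 by rewrite ltr_wpDl.
have [phi [Cphi phi0 vphi]] := v_ _ (divr_gt0 e0 k1).
have [psi [Cpsi psi0 wpsi]] := w_ _ (divr_gt0 e0 k1).
exists (fun x => k * phi x + psi x); split.
- by move=> i; apply: C_kD => //; exact: C_kZ.
- by move=> x fx; rewrite phi0// psi0// mulr0 addr0.
rewrite (_ : _ \- _ = fun x => k * (v \- phi) x + (w \- psi) x); last first.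
  by apply/funext => x /=; ring.
have md g h : Hs s Om g -> C_infty h -> measurable_fun Om (g \- h).
  by move=> [mg _] Ch; apply: measurable_funB => //; exact: C_infty_measurable.
apply: le_lt_trans (Hs_norm_lincomb k (md _ _ Hv Cphi) (md _ _ Hw Cpsi)) _.
have -> : e = `|k| * (e / (`|k| + 1)) + e / (`|k| + 1) by field; rewrite gt_eqF.
rewrite EFinD EFinM lee_ltD//.
  by rewrite fin_numM// ge0_fin_numE ?Hs_norm_ge0// (lt_trans vphi) ?ltry.
by rewrite lee_wpmul2l ?lee_fin// ltW.
Qed.

Lemma Hs0B v w : Hs0 s Om v -> Hs0 s Om w -> Hs0 s Om (v \- w).
Proof.
move=> Hv Hw; rewrite (_ : v \- w = fun x => -1 * w x + v x).
  exact: Hs0_lincomb.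
by apply/funext => x /=; ring.
Qed.

Lemma Hs0Z (k : R) v : Hs0 s Om v -> Hs0 s Om (fun x => k * v x).
Proof.
move=> Hv; rewrite (_ : (fun x => _) = fun x => k * v x + 0).
  exact: (Hs0_lincomb k Hv Hs0_0).
by apply/funext => x; rewrite addr0.
Qed.

End Hs.

(** * Square-integrable functions and the pairing *)

Section L2.
Context {R : realType} {n : nat}.
Variable Om : set 'rV[R]_n.
Hypothesis mOm : measurable Om.
Implicit Types f g v w : 'rV[R]_n -> R.
Local Notation mu := (@lebesgue_rV R n).

Definition L2 : set ('rV[R]_n -> R) :=
  [set v | measurable_fun Om v /\ (L2_norm Om v < +oo)%E].

Lemma L2P v : L2 v <-> v \_ Om \in Lfun mu 2%:E.
Proof.
split=> [[mv fv]|/andP[/[!inE] mv fv]].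
  by apply/andP; rewrite !inE; split => //; exact/(measurable_restrictT _ mOm).
by split => //; exact/(measurable_restrictT _ mOm).
Qed.

Lemma L2_le v w : measurable_fun Om v -> (forall x, `|v x| <= `|w x|) ->
  L2 w -> L2 v.
Proof.
move=> mv vw [mw fw]; split => //; apply: le_lt_trans fw.
apply: le_Lnorm2; [exact/(measurable_restrictT _ mOm)..|].
by move=> x; rewrite /patch; case: ifP.
Qed.

Lemma L2_lincomb (k : R) v w : L2 v -> L2 w -> L2 (fun x => k * v x + w x).
Proof.
move=> [mv fv] [mw fw]; split.
  by apply: measurable_funD => //; exact: measurable_funM.
rewrite /L2_norm (_ : _ \_ Om = fun x => k * (v \_ Om) x + (w \_ Om) x);
  last by apply/funext => x; rewrite /patch; case: ifP => // _;
    rewrite mulr0 addr0.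
apply: le_lt_trans (Lnorm2_lincomb _ _ _ _) _;
  try exact/(measurable_restrictT _ mOm).
by rewrite lte_add_pinfty// lte_mul_pinfty ?lee_fin.
Qed.

Lemma L2B v w : L2 v -> L2 w -> L2 (v \- w).
Proof.
move=> Lv Lw; rewrite (_ : v \- w = fun x => -1 * w x + v x).
  exact: L2_lincomb.
by apply/funext => x /=; ring.
Qed.

Lemma L2_norm_fun v : L2 v -> L2 (fun x => `|v x|).
Proof.
move=> Lv; apply: (L2_le _ _ Lv) => [|x]; last by rewrite normr_id.
by apply: measurableT_comp => //; have [] := Lv.
Qed.

Lemma L2_integrable v w : L2 v -> L2 w ->
  mu.-integrable Om (EFin \o (fun x => v x * w x)).
Proof.
move=> Lv Lw; apply/integrable_mkcond => //; rewrite restrict_EFin.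
rewrite (_ : _ \_ Om = v \_ Om \* w \_ Om); last first.
  by apply/funext => x; rewrite /patch /=; case: ifP; rewrite ?mulr0.
by apply/Lfun1_integrable/Lfun2_mul_Lfun1; exact/L2P.
Qed.

Lemma pairingZr (k : R) g v : L2 g -> L2 v ->
  pairing Om g (fun x => k * v x) = k * pairing Om g v.
Proof.
move=> Lg Lv; rewrite /pairing -RintegralZl//; last exact: L2_integrable.
by apply: eq_Rintegral => x _; ring.
Qed.

Lemma pairingDr g v w : L2 g -> L2 v -> L2 w ->
  pairing Om g (fun x => v x + w x) = pairing Om g v + pairing Om g w.
Proof.
move=> Lg Lv Lw; rewrite /pairing -RintegralD//; try exact: L2_integrable.
by apply: eq_Rintegral => x _; ring.
Qed.

Lemma pairingBr g v w : L2 g -> L2 v -> L2 w ->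
  pairing Om g (v \- w) = pairing Om g v - pairing Om g w.
Proof.
move=> Lg Lv Lw; rewrite /pairing -RintegralB//; try exact: L2_integrable.
by apply: eq_Rintegral => x _ /=; ring.
Qed.

Lemma le_pairing g1 v1 g2 v2 : L2 g1 -> L2 v1 -> L2 g2 -> L2 v2 ->
  (forall x, Om x -> g1 x * v1 x <= g2 x * v2 x) ->
  pairing Om g1 v1 <= pairing Om g2 v2.
Proof. by move=> *; apply: le_Rintegral => //; exact: L2_integrable. Qed.

Lemma pairing_cauchy_schwarz g v : L2 g -> L2 v ->
  ((pairing Om (fun x => `|g x|) (fun x => `|v x|))%:E <=
    L2_norm Om g * L2_norm Om v)%E.
Proof.
move=> Lg Lv.
have /andP[/[!inE] mg _] := (L2P g).1 Lg.
have /andP[/[!inE] mv _] := (L2P v).1 Lv.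
have Ia := L2_integrable (L2_norm_fun Lg) (L2_norm_fun Lv).
have -> : (pairing Om (fun x => `|g x|) (fun x => `|v x|))%:E =
    'N[mu]_1[EFin \o (g \_ Om \* v \_ Om)%R]%E.
  rewrite /pairing/Rintegral fineK ?integrable_fin_num// Lnorm1 integral_mkcond.
  apply: eq_integral => x _ /=.
  by rewrite /patch; case: ifP; rewrite ?mulr0 ?normr0// normrM.
by apply: hoelder => //; rewrite [RHS]splitr !div1r.
Qed.

Hypothesis bOm : (mu Om < +oo)%E.

Lemma L2_bounded v (M : R) : measurable_fun Om v ->
  {ae mu, forall x, Om x -> `|v x| <= M} -> L2 v.
Proof.
move=> mv vM; split => //; rewrite /L2_norm unlock poweR_lty//.
apply: (@le_lt_trans _ _ (\int[mu]_x ((cst (M ^+ 2)) \_ Om x)%:E)%E).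
  apply: ae_ge0_le_integral => //.
  - by move=> x _; exact: poweR_ge0.
  - exact/measurable_abse_sq/(measurable_restrictT _ mOm).
  - by move=> x _; rewrite lee_fin /patch; case: ifP => // _; exact: sqr_ge0.
  - apply/measurable_EFinP/(measurable_restrictT _ mOm); exact: measurable_cst.
  - apply: filterS vM => x vM _; rewrite lee_fin /patch.
    case: ifPn => [/set_mem/vM xM|_]; last by rewrite normr0 powR0.
    rewrite powR_mulrn//; apply: lerXn2r; rewrite ?nnegrE//.
    exact: le_trans (normr_ge0 _) xM.
rewrite (_ : (\int[mu]_x _)%E = (\int[mu]_(x in Om) (M ^+ 2)%:E)%E).
  rewrite integral_cst//.
  by rewrite lte_mul_pinfty ?lee_fin ?sqr_ge0.
rewrite [RHS]integral_mkcond; apply: eq_integral => x _.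
by rewrite /patch; case: ifP.
Qed.

Lemma L2_cst (c : R) : L2 (fun=> c).
Proof.
by apply: (@L2_bounded _ `|c|) => //; exact: aeW.
Qed.

(** The norm in the definition of [Linfty] is an essential supremum only
    when the whole space has positive measure; otherwise every bound holds
    almost everywhere. *)
Lemma L2_Linfty v : Linfty Om v -> L2 v.
Proof.
move=> [mv]; rewrite unlock.
have aeO (M : R) : {ae mu, forall x, `|(v \_ Om) x| <= M} -> L2 v.
  move=> vM; apply: (@L2_bounded _ M) => //; apply: filterS vM => x /= + Ox.
  by rewrite /patch mem_set.
case: ifPn => [_ /ess_supr_bounded[M]|mu0 _]; first exact: aeO.
apply: (aeO 0); exists setT; split => //.
by apply/eqP; rewrite eq_le measure_ge0 andbT leNgt.
Qed.

End L2.

(** * Bounds by the dual norm *)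

Lemma le_slack {R : realFieldType} (A B c : R) : 0 <= c ->
  (forall eta, 0 < eta -> A <= B + c * eta) -> A <= B.
Proof.
move=> c0 AB; apply/ler_addgt0Pl => e e0.
have c1 : 0 < c + 1 by rewrite ltr_wpDl.
have := AB _ (divr_gt0 e0 c1); have : c * (e / (c + 1)) <= e.
  by rewrite mulrCA ger_pMr// ler_pdivrMr// mul1r lerDl.
lra.
Qed.

Section dual.
Context {R : realType} {n : nat}.
Variables (s : R) (Om : set 'rV[R]_n).
Hypothesis mOm : measurable Om.
Implicit Types f g u v w : 'rV[R]_n -> R.
Implicit Types L : ('rV[R]_n -> R) -> R.
Local Notation mu := (@lebesgue_rV R n).

Lemma Hs0_L2 v : Hs0 s Om v -> L2 Om v.
Proof.
move=> [[mv fv] _]; split => //; apply: le_lt_trans fv.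
by rewrite /Hs_norm leeDl// /Hs_seminorm poweR_ge0.
Qed.

Lemma Hs0_fin_num v : Hs0 s Om v -> Hs_norm s Om v \is a fin_num.
Proof. by move=> [[_ fv] _]; rewrite ge0_fin_numE ?Hs_norm_ge0. Qed.

Lemma dual_norm_ge0 L : (0 <= dual_norm s Om L)%E.
Proof.
apply: (@le_trans _ _ `|L (fun=> 0)|%:E); first by rewrite lee_fin.
apply: ereal_sup_ubound; exists (fun=> 0) => //; split; first exact: Hs0_0.
by rewrite Hs_norm0.
Qed.

(** Scaling [v] by [E + eta] rather than by [E] covers the case of a
    vanishing norm. *)
Lemma dual_norm_bound L (D E : R) v :
  (forall k w, Hs0 s Om w -> L (fun x => k * w x) = k * L w) ->
  (dual_norm s Om L <= D%:E)%E -> Hs0 s Om v -> (Hs_norm s Om v <= E%:E)%E ->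
  `|L v| <= D * E.
Proof.
move=> LZ LD Hv vE.
have E0 : 0 <= E by rewrite -lee_fin (le_trans (Hs_norm_ge0 _ _ _) vE).
have D0 : 0 <= D by rewrite -lee_fin (le_trans (dual_norm_ge0 _) LD).
apply: (@le_slack _ _ _ D) => // eta eta0; rewrite -mulrDr.
have t0 : 0 < E + eta by rewrite ltr_wpDl.
have : (`|L (fun x => (E + eta)^-1 * v x)|%:E <= D%:E)%E.
  apply: le_trans LD; apply: ereal_sup_ubound.
  exists (fun x => (E + eta)^-1 * v x) => //; split; first exact: Hs0Z.
  have [mv _] := Hv.1; rewrite Hs_normZ// gtr0_norm ?invr_gt0//.
  apply: (@le_trans _ _ ((E + eta)^-1%:E * E%:E)%E).
    by rewrite lee_wpmul2l// lee_fin invr_ge0 ltW.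
  by rewrite -EFinM lee_fin mulrC ler_pdivrMr// mul1r lerDl ltW.
by rewrite LZ// lee_fin normrM gtr0_norm ?invr_gt0// mulrC ler_pdivrMr.
Qed.

Hypothesis bOm : (mu Om < +oo)%E.

(** The estimate for [|v|] that the dual norm gives for elements of [Hs0],
    without [|v|] being one: [|v|] is replaced by the smooth absolute
    value of a smooth approximation of [v], at an error that is linear in
    [eta]. *)
Lemma pairing_abs_le g v (D E : R) : L2 Om g -> Hs0 s Om v ->
  (dual_norm s Om (pairing Om g) <= D%:E)%E -> (Hs_norm s Om v <= E%:E)%E ->
  pairing Om g (fun x => `|v x|) <= D * E.
Proof.
move=> Lg Hv gD vE; have Lv := Hs0_L2 Hv; have [mv _] := Hv.1.
have D0 : 0 <= D by rewrite -lee_fin (le_trans (dual_norm_ge0 _) gD).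
have gZ k w : Hs0 s Om w ->
    pairing Om g (fun x => k * w x) = k * pairing Om g w.
  by move=> /Hs0_L2; exact: pairingZr.
pose a := fine (L2_norm Om g); pose b := pairing Om (fun x => `|g x|) (fun=> 1).
have a0 : 0 <= a by rewrite fine_ge0// Lnorm_ge0.
have b0 : 0 <= b by apply: Rintegral_ge0 => x _; rewrite mulr1.
apply: (@le_slack _ _ _ (D + a + b)); first by rewrite !addr_ge0.
move=> eta eta0; have [phi [Cphi phi0 vphi]] := Hv.2 _ eta0.
have mphi : measurable_fun Om phi := C_infty_measurable Cphi.
have mvphi : measurable_fun Om (v \- phi) by exact: measurable_funB.
pose psi := smooth_abs eta \o phi.
have Cpsi : C_infty psi by exact: C_infty_smooth_abs.
have psi_le : (Hs_norm s Om psi <= (E + eta)%:E)%E.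
  apply: (@le_trans _ _ (Hs_norm s Om phi)).
    apply: le_Hs_norm => //; first exact: C_infty_measurable.
      move=> x; rewrite -[phi x in leRHS]subr0 -[psi x]subr0.
      rewrite -{1}(smooth_abs0 (ltW eta0)).
      exact: smooth_abs_lip.
    by move=> x y; exact: smooth_abs_lip.
  rewrite (_ : phi = fun x => -1 * (v \- phi) x + v x); last first.
    by apply/funext => x /=; ring.
  apply: (le_trans (Hs_norm_lincomb s mOm _ mvphi mv)).
  by rewrite normrN1 mul1e addeC EFinD leeD// ltW.
have Hpsi : Hs0 s Om psi.
  apply: Hs0_smooth => //; last by rewrite (le_lt_trans psi_le) ?ltry.
  by move=> x fx; rewrite /psi /= phi0// smooth_abs0// ltW.
have := dual_norm_bound gZ gD Hpsi psi_le.
have Lvphi : L2 Om (v \- phi).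
  split=> //; apply: (@lt_trans _ _ eta%:E); last by rewrite ltry.
  apply: le_lt_trans vphi; by rewrite /Hs_norm leeDl// /Hs_seminorm poweR_ge0.
have CS : pairing Om (fun x => `|g x|) (fun x => `|(v \- phi) x|) <= a * eta.
  rewrite -lee_fin; apply: (le_trans (pairing_cauchy_schwarz mOm Lg Lvphi)).
  rewrite EFinM /a fineK ?ge0_fin_numE ?Lnorm_ge0 ?Lg.2//.
  rewrite lee_wpmul2l ?Lnorm_ge0// (le_trans _ (ltW vphi))//.
  by rewrite /Hs_norm leeDl// /Hs_seminorm poweR_ge0.
have Lpsi := Hs0_L2 Hpsi; have Lg' := L2_norm_fun mOm Lg.
have Le : L2 Om (fun x => eta * 1 + `|(v \- phi) x|).
  apply: L2_lincomb => //; first exact: L2_cst.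
  exact: L2_norm_fun.
have vpsi : pairing Om g (fun x => `|v x| - psi x) <=
    eta * b + pairing Om (fun x => `|g x|) (fun x => `|(v \- phi) x|).
  rewrite -pairingZr//; last exact: L2_cst.
  rewrite -pairingDr//; last exact: L2_norm_fun.
    apply: le_pairing => // [|x _]; first exact: (L2B mOm (L2_norm_fun mOm Lv)).
    apply: le_trans (ler_norm _) _; rewrite normrM ler_wpM2l// mulr1.
    have := ler_normD (`|v x| - `|phi x|) (`|phi x| - psi x).
    have := ler_dist_dist (v x) (phi x).
    have := smooth_abs_near (phi x) (ltW eta0).
    rewrite addrA subrK /= -/(psi x); lra.
  rewrite (_ : (fun x => eta * 1) = fun=> eta); first exact: L2_cst.
  by apply/funext => x; rewrite mulr1.
rewrite (@pairingBr _ _ _ _ g (fun x => `|v x|) psi) in vpsi => //.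
  have := ler_norm (pairing Om g psi).
  move: CS vpsi; lra.
exact: L2_norm_fun.
Qed.

End dual.

(** * Bilinearity of the energy form *)

Section a_form.
Context {R : realType} {n : nat}.
Variables (s : R) (Om : set 'rV[R]_n).
Hypothesis mOm : measurable Om.
Hypothesis acont : a_continuous s Om.
Implicit Types f g u v w : 'rV[R]_n -> R.

Lemma a_form_sym u v : a_form s Om u v = a_form s Om v u.
Proof.
rewrite /a_form; congr (_ * _); apply: eq_Rintegral => z _.
by rewrite /a_integrand; ring.
Qed.

Lemma measurable_a_domain : measurable (a_domain Om).
Proof. by apply: measurableU; apply: measurableX. Qed.

Lemma a_formBr u v w : Hs0 s Om u -> Hs0 s Om v -> Hs0 s Om w ->
  a_form s Om u (v \- w) = a_form s Om u v - a_form s Om u w.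
Proof.
move=> Hu Hv Hw; rewrite /a_form -mulrBr; congr (_ * _).
have [int _] := acont.
rewrite -RintegralB; [|exact: measurable_a_domain|exact: int|exact: int].
apply: eq_Rintegral => z _; rewrite /a_integrand.
have E x : ((v \- w) \_ Om) x = (v \_ Om) x - (w \_ Om) x.
  by rewrite /patch; case: ifP => // _; rewrite subr0.
by rewrite !E; ring.
Qed.

Lemma a_formBl u v w : Hs0 s Om u -> Hs0 s Om v -> Hs0 s Om w ->
  a_form s Om (v \- w) u = a_form s Om v u - a_form s Om w u.
Proof.
move=> Hu Hv Hw.
by rewrite a_form_sym a_formBr// a_form_sym (a_form_sym _ w).
Qed.

Lemma a_formZr (k : R) u v : Hs0 s Om u -> Hs0 s Om v ->
  a_form s Om u (fun x => k * v x) = k * a_form s Om u v.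
Proof.
move=> Hu Hv; rewrite /a_form [k * _]mulrCA; congr (_ * _).
rewrite -RintegralZl; [|exact: measurable_a_domain|exact: acont.1].
apply: eq_Rintegral => z _; rewrite /a_integrand.
have E x : ((fun x => k * v x) \_ Om) x = k * (v \_ Om) x.
  by rewrite /patch; case: ifP => // _; rewrite mulr0.
by rewrite !E; ring.
Qed.

End a_form.

(** * The error estimate *)

(** Here [p] and [m] are the positive and negative parts of [|t| - G].
    Since [t a <= |t| |a|], the terms in [a] contribute at most [p |a|],
    while [G |b| = |t| |b| - p |b| + m |b|]; the two occurrences of [p]
    combine through [|a| - |b| <= |a - b|]. Using [p >= 0] at this point
    is what makes [|a - b|], and not [|a| - |b|], the function to be
    measured in [H^s]. *)
Lemma friction_pointwise (R : realType) (t G a b p m : R) :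
  0 <= p -> 0 <= m -> p - m = `|t| - G ->
  t * (a - b) + G * `|b| - G * `|a| <=
  p * `|a - b| + (m * `|b| - t * b + `|t| * `|b|).
Proof.
move=> p0 m0 pm; have ma := mulr_ge0 m0 (normr_ge0 a).
have pab : p * `|a| <= p * (`|a - b| + `|b|).
  by rewrite ler_wpM2l// -lerBlDr lerB_dist.
have ta : t * a <= `|t| * `|a| by rewrite -normrM ler_norm.
have : (p - m) * `|a| = (`|t| - G) * `|a| by rewrite pm.
have : (p - m) * `|b| = (`|t| - G) * `|b| by rewrite pm.
lra.
Qed.

Section estimate.
Context {R : realType} {n : nat}.
Variables (Om : set 'rV[R]_n).
Hypothesis mOm : measurable Om.
Local Notation mu := (@lebesgue_rV R n).
Implicit Types f g u v w : 'rV[R]_n -> R.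

Lemma frictionE (S : set 'rV[R]_n) F v : S `<=` Om ->
  friction S F v = pairing Om (F \_ S) (fun x => `|v x|).
Proof.
move=> SO; rewrite /friction /pairing Rintegral_mkcond [RHS]Rintegral_mkcond.
apply: eq_Rintegral => x _; rewrite /patch.
case: ifPn => [xS|_]; last by case: ifP => // _; rewrite mul0r.
by rewrite mem_set//; apply: SO; exact: set_mem.
Qed.

Lemma friction_integrated t G a b p m :
  L2 Om t -> L2 Om G -> L2 Om a -> L2 Om b -> L2 Om p -> L2 Om m ->
  (forall x, 0 <= p x) -> (forall x, 0 <= m x) ->
  (forall x, p x - m x = `|t x| - G x) ->
  pairing Om t (a \- b) + pairing Om G (fun x => `|b x|) -
    pairing Om G (fun x => `|a x|) <=
  pairing Om p (fun x => `|(a \- b) x|) +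
    (pairing Om m (fun x => `|b x|) - pairing Om t b +
     pairing Om (fun x => `|t x|) (fun x => `|b x|)).
Proof.
move=> Lt LG La Lb Lp Lm p0 m0 pm.
have iD (h k : 'rV[R]_n -> R) : mu.-integrable Om (EFin \o h) ->
    mu.-integrable Om (EFin \o k) -> mu.-integrable Om (EFin \o (h \+ k)).
  by move=> ih ik; exact: (integrableD mOm ih ik).
have iB (h k : 'rV[R]_n -> R) : mu.-integrable Om (EFin \o h) ->
    mu.-integrable Om (EFin \o k) -> mu.-integrable Om (EFin \o (h \- k)).
  by move=> ih ik; exact: (integrableB mOm ih ik).
have Lab := L2B mOm La Lb; have Labn := L2_norm_fun mOm Lab.
have Lan := L2_norm_fun mOm La; have Lbn := L2_norm_fun mOm Lb.
have Ltn := L2_norm_fun mOm Lt.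
have i1 := L2_integrable mOm Lt Lab; have i2 := L2_integrable mOm LG Lbn.
have i3 := L2_integrable mOm LG Lan; have i4 := L2_integrable mOm Lp Labn.
have i5 := L2_integrable mOm Lm Lbn; have i6 := L2_integrable mOm Lt Lb.
have i7 := L2_integrable mOm Ltn Lbn.
rewrite -(RintegralD mOm i1 i2) -(RintegralB mOm (iD _ _ i1 i2) i3).
rewrite -(RintegralB mOm i5 i6) -(RintegralD mOm (iB _ _ i5 i6) i7).
rewrite -(RintegralD mOm i4 (iD _ _ (iB _ _ i5 i6) i7)).
apply: le_Rintegral => //; first exact: (iB _ _ (iD _ _ i1 i2) i3).
  exact: (iD _ _ i4 (iD _ _ (iB _ _ i5 i6) i7)).
by move=> x _; exact: friction_pointwise.
Qed.

End estimate.

(** Young's inequality absorbs the terms linear in [E] into [al * E ^+ 2]. *)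
Lemma quadratic_absorption (R : realType) (al m E Z D1 D2 X : R) :
  0 < al -> 0 <= X -> al * E ^+ 2 <= D1 * E + D2 * E + X ->
  0 <= Z -> Z <= D1 + m * E ->
  E ^+ 2 + Z ^+ 2 <=
  ((1 + 2 * m ^+ 2) * (2 / al ^+ 2 + 2 / al) + 2) * (D1 ^+ 2 + D2 ^+ 2 + X).
Proof.
move=> al0 X0 hE Z0 hZ.
set i := al^-1; have i0 : 0 < i by rewrite invr_gt0.
have E1 : E ^+ 2 <= 2 * i ^+ 2 * (D1 ^+ 2 + D2 ^+ 2) + 2 * i * X.
  have : E ^+ 2 <= i * (D1 + D2) * E + i * X.
    have := ler_wpM2l (ltW i0) hE.
    rewrite mulrA mulVf ?gt_eqF// mul1r; lra.
  have := sqr_ge0 (E - i * (D1 + D2)).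
  have := sqr_ge0 (i * (D1 - D2)).
  lra.
have Z1 : Z ^+ 2 <= 2 * D1 ^+ 2 + 2 * m ^+ 2 * E ^+ 2.
  apply: (@le_trans _ _ ((D1 + m * E) ^+ 2)).
    by rewrite lerXn2r// nnegrE// (le_trans Z0).
  have := sqr_ge0 (D1 - m * E); lra.
have E2 : E ^+ 2 <= (2 * i ^+ 2 + 2 * i) * (D1 ^+ 2 + D2 ^+ 2 + X).
  have := sqr_ge0 i; have := sqr_ge0 D1; have := sqr_ge0 D2.
  nra.
have := ler_wpM2l (addr_ge0 ler01 (mulr_ge0 (ler0n _ 2) (sqr_ge0 m))) E2.
rewrite exprVn -/i; have := sqr_ge0 D1; have := sqr_ge0 D2; lra.
Qed.

Theorem lemma5p9 (R : realType) (n : nat) (s : R) (Om : set 'rV[R]_n)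
    (kappa : R) :
  (0 < n)%N -> 0 < s -> s < 1 ->
  bounded_lipschitz_domain Om -> polygonal_boundary Om ->
  a_continuous s Om -> a_coercive s Om ->
  exists2 C : R, 0 < C &
  forall (Th : seq 'M[R]_(n.+1, n)) (S : set 'rV[R]_n)
    (F f u uh sigmah : 'rV[R]_n -> R) (sigma : ('rV[R]_n -> R) -> R),
  triangulation Om Th -> shape_regular kappa Th ->
  open S -> S `<=` Om ->
  Linfty Om F -> {ae lebesgue_rV n, forall x, Om x -> 0 <= F x} ->
  V_h s Om Th f ->
  Hs0 s Om u ->
  (forall v, Hs0 s Om v ->
     a_form s Om u (v \- u) + friction S F v - friction S F u
       >= pairing Om f (v \- u)) ->
  V_h s Om Th uh ->
  (forall vh, V_h s Om Th vh ->
     a_form s Om uh (vh \- uh) + friction S F vh - friction S F uh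
       >= pairing Om f (vh \- uh)) ->
  Hs_dual s Om sigma ->
  (forall v, Hs0 s Om v -> sigma v = pairing Om f v - a_form s Om u v) ->
  V_h s Om Th sigmah ->
  (forall vh, V_h s Om Th vh ->
     pairing Om sigmah vh = pairing Om f vh - a_form s Om uh vh) ->
  let rh := pairing Om f \- fracLap s Om uh in
  let absuh := fun x => `|uh x| in
  let abssigmah := fun x => `|sigmah x| in
  let excess := abssigmah \- (F \_ S) in
  (Hs_norm s Om (u \- uh)%R ^+ 2 +
     dual_norm s Om (sigma \- pairing Om sigmah)%R ^+ 2
   <= C%:E *
     (dual_norm s Om (rh \- pairing Om sigmah)%R ^+ 2 +
      dual_norm s Om (pairing Om excess^\+%R) ^+ 2 +
      (pairing Om excess^\- absuh - pairing Om sigmah uh +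
       pairing Om abssigmah absuh)%R%:E))%E.
Proof.
move=> n0 s0 s1 [oOm _ _ bOm _] _ acont [al al0 acoer].
have mOm := open_measurable_rV oOm.
have fOm := bounded_lebesgue_rV mOm bOm.
have [_ [M aM]] := acont.
have C0 : 0 < (1 + 2 * `|M| ^+ 2) * (2 / al ^+ 2 + 2 / al) + 2.
  have c1 : 0 < 1 + 2 * `|M| ^+ 2 by have := sqr_ge0 `|M|; lra.
  have c2 : 0 < 2 / al ^+ 2 + 2 / al by rewrite addr_gt0 ?divr_gt0 ?exprn_gt0.
  by have := mulr_gt0 c1 c2; lra.
exists ((1 + 2 * `|M| ^+ 2) * (2 / al ^+ 2 + 2 / al) + 2).
  exact: C0.
move=> Th S F f u uh sigmah sigma _ _ oS SOm LF _ [Hf _ _ _] Hu VI.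
move=> [Huh _ _ _] _.
move=> _ sigmaE [Hsh _ _ _] _; cbv zeta.
set rh := (pairing Om f \- _); set excess := (_ \- F \_ S).
have mS := open_measurable_rV oS.
have Lf := Hs0_L2 Hf; have Lu := Hs0_L2 Hu.
have Luh := Hs0_L2 Huh; have Lsh := Hs0_L2 Hsh.
have LFS : L2 Om (F \_ S).
  have [mF _] := LF.
  apply: (L2_le mOm _ _ (L2_Linfty mOm fOm LF)).
    by apply/measurable_restrict => //; exact: measurable_funS mF.
  by move=> x; rewrite /patch; case: ifP => //; rewrite normr0.
have Lex : L2 Om excess by exact: (L2B mOm (L2_norm_fun mOm Lsh) LFS).
have funrposDnegE x : excess^\+ x + excess^\- x = `|excess x|.
  exact: (congr1 (@^~ x) (funrposDneg excess)).
have Lexp : L2 Om excess^\+.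
  apply: (L2_le mOm _ _ Lex); first by apply: measurable_funrpos; case: Lex.
  move=> x; rewrite -[leRHS](funrposDnegE x) ger0_norm ?funrpos_ge0//.
  by rewrite lerDl funrneg_ge0.
have Lexn : L2 Om excess^\-.
  apply: (L2_le mOm _ _ Lex); first by apply: measurable_funrneg; case: Lex.
  move=> x; rewrite -[leRHS](funrposDnegE x) ger0_norm ?funrneg_ge0//.
  by rewrite lerDr funrpos_ge0.
have He := Hs0B mOm Hu Huh; set e := (u \- uh)%R in He *.
have Le := Hs0_L2 He.
pose X := pairing Om excess^\- (fun x => `|uh x|) - pairing Om sigmah uh +
  pairing Om (fun x => `|sigmah x|) (fun x => `|uh x|).
have Luhn := L2_norm_fun mOm Luh; have Lshn := L2_norm_fun mOm Lsh.
have X0 : 0 <= X.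
  rewrite /X -addrA addr_ge0//.
    by apply: Rintegral_ge0 => x _; rewrite mulr_ge0.
  rewrite addrC subr_ge0; apply: le_pairing => // x _.
  by rewrite -normrM ler_norm.
rewrite -/X.
set D1 := dual_norm s Om (rh \- _)%R.
set D2 := dual_norm s Om (pairing Om excess^\+).
have D10 : (0 <= D1)%E by exact: dual_norm_ge0.
have D20 : (0 <= D2)%E by exact: dual_norm_ge0.
have sq_neqNy (y : \bar R) : (0 <= y)%E -> (y ^+ 2 != -oo)%E.
  by move=> y0; rewrite gt_eqF// (lt_le_trans ltNy0)// expe_ge0.
(* An infinite dual norm on the right makes the estimate trivial. *)
have [D1oo|D1fin] := eqVneq D1 +oo%E.
  rewrite D1oo (expe2 +oo%E) mulyy addye ?sq_neqNy// addye//.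
  by rewrite gt0_muley ?lte_fin// leey.
have [D2oo|D2fin] := eqVneq D2 +oo%E.
  rewrite D2oo (expe2 +oo%E) mulyy addey ?sq_neqNy// addye//.
  by rewrite gt0_muley ?lte_fin// leey.
have rhZ k v : Hs0 s Om v -> (rh \- pairing Om sigmah)%R (fun x => k * v x) =
    k * (rh \- pairing Om sigmah)%R v.
  move=> Hv; have Lv := Hs0_L2 Hv.
  by rewrite /rh /fracLap /= !pairingZr// a_formZr//; ring.
pose d1 := fine D1; pose d2 := fine D2; pose E := fine (Hs_norm s Om e).
have D1E : D1 = d1%:E by rewrite fineK// ge0_fin_numE// lt_neqAle D1fin leey.
have D2E : D2 = d2%:E by rewrite fineK// ge0_fin_numE// lt_neqAle D2fin leey.
have EE : Hs_norm s Om e = E%:E by rewrite fineK// Hs0_fin_num.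
have rhe : (rh \- pairing Om sigmah)%R e <= d1 * E.
  apply: le_trans (ler_norm _) _; apply: dual_norm_bound rhZ _ He _ => //.
    by rewrite -D1E.
  by rewrite EE.
have exe : pairing Om excess^\+ (fun x => `|e x|) <= d2 * E.
  by apply: (@pairing_abs_le _ _ s) => //; rewrite ?EE// -D2E.
have coer : al * E ^+ 2 <= d1 * E + d2 * E + X.
  have : al * E ^+ 2 <= a_form s Om e e.
    by rewrite -lee_fin EFinM EFin_expe -EE; exact: acoer.
  have ape : a_form s Om e e = a_form s Om u e - a_form s Om uh e.
    exact: a_formBl.
  have := VI _ Huh; rewrite (frictionE F uh SOm) (frictionE F u SOm).
  rewrite (a_formBr mOm acont Hu Huh Hu) (pairingBr mOm Lf Luh Lu).
  have aue : a_form s Om u e = a_form s Om u u - a_form s Om u uh.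
    exact: a_formBr.
  have pfe : pairing Om f e = pairing Om f u - pairing Om f uh.
    exact: pairingBr.
  have : pairing Om sigmah e + pairing Om (F \_ S) (fun x => `|uh x|) -
      pairing Om (F \_ S) (fun x => `|u x|) <=
      pairing Om excess^\+ (fun x => `|e x|) + X.
    apply: friction_integrated => // x.
    exact: (congr1 (@^~ x) (funrposBneg excess)).
  move: rhe; rewrite /rh /fracLap /= -/e; lra.
have dualE : (dual_norm s Om (sigma \- pairing Om sigmah)%R <=
    (d1 + `|M| * E)%:E)%E.
  apply: ub_ereal_sup => _ [v [Hv v1] <-]; have Lv := Hs0_L2 Hv.
  rewrite lee_fin.
  have -> : (sigma \- pairing Om sigmah)%R v =
      (rh \- pairing Om sigmah)%R v - a_form s Om e v.
    by rewrite /= sigmaE// /rh /= /fracLap (a_formBl mOm acont Hv Hu Huh); ring.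
  apply: le_trans (ler_normB _ _) _; apply: lerD.
    rewrite -[d1]mulr1; apply: dual_norm_bound rhZ _ Hv v1 => //.
    by rewrite -D1E.
  have := aM _ _ He Hv; rewrite EE -(fineK (Hs0_fin_num Hv)) -!EFinM lee_fin.
  move/le_trans; apply; rewrite -mulrA.
  have E0 : 0 <= E by rewrite fine_ge0// Hs_norm_ge0.
  have N0 : 0 <= fine (Hs_norm s Om v) by rewrite fine_ge0// Hs_norm_ge0.
  have N1 : fine (Hs_norm s Om v) <= 1 by rewrite -lee_fin fineK// Hs0_fin_num.
  apply: (@le_trans _ _ (`|M| * (E * fine (Hs_norm s Om v)))).
    by rewrite ler_wpM2r ?mulr_ge0// ler_norm.
  by rewrite ler_wpM2l// ler_piMr.
set Z := dual_norm s Om (sigma \- _)%R in dualE *.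
have Z0 : (0 <= Z)%E  by exact: dual_norm_ge0.
have ZE : Z = (fine Z)%:E.
  by rewrite fineK// ge0_fin_numE// (le_lt_trans dualE)// ltry.
rewrite EE ZE D1E D2E -!EFin_expe -!EFinD -EFinM lee_fin.
apply: quadratic_absorption => //; first by rewrite -lee_fin -ZE.
by rewrite -lee_fin -ZE.
Qed.
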